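(* Let $\mathcal{I},\mathcal{J},\mathcal{K}\subset\Pi$ with $\mathcal{I},\mathcal{K}\subset\mathcal{J}$, and let $\Gamma(\mathcal{I},\mathcal{J},\mathcal{K})=\Phi_{\mathcal{I}}\cup(\Phi^+_{\mathcal{J}}\setminus\Phi_{\mathcal{K}})$. Then $\Gamma(\mathcal{I},\mathcal{J},\mathcal{K})$ is closed if and only if there exist $\mathcal{X},\mathcal{Y}\subset\mathcal{J}$ such that: (1) $\mathcal{I}\cup\mathcal{K}=\mathcal{X}\coprod\mathcal{Y}$ (disjoint union); (2) $\mathcal{X}$ is orthogonal to $\mathcal{Y}$; (3) $\mathcal{X}\supset\mathcal{I}\setminus\mathcal{K}$ and $\mathcal{Y}\supset\mathcal{K}\setminus\mathcal{I}$.
   Context: $\Phi$ is the root system of a connected semisimple algebraic group over $\mathbb{C}$, with inner product $(\cdot,\cdot)$, simple roots $\Pi$ and positive roots $\Phi^+$. For $A\subset\Pi$, $\Phi_A$ is the minimal root subsystem of $\Phi$ containing $A$ and $\Phi_A^+=\Phi_A\cap\Phi^+$. A subset $\Gamma\subset\Phi$ is closed if $\alpha,\beta\in\Gamma$ and $\alpha+\beta\in\Phi$ imply $\alpha+\beta\in\Gamma$. Two subsets are orthogonal if $(x,y)=0$ for every $x$ in the first and $y$ in the second. *)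

(* Defs.v *)
From mathcomp Require Import all_boot all_order all_algebra.
From mathcomp Require Import finmap.
From mathcomp Require Import boolp classical_sets functions cardinality fsbigop.
From mathcomp Require Import reals.

Set Implicit Arguments.
Unset Strict Implicit.
Unset Printing Implicit Defensive.

Import Order.TTheory GRing.Theory Num.Theory.

Local Open Scope classical_set_scope.
Local Open Scope ring_scope.

(* The root systems of connected semisimple complex algebraic groups are exactly
   the reduced crystallographic root systems, which is what is axiomatised here.
   [dot : {dot V for idfun}] is a symmetric positive definite bilinear form on
   [V], so that [V] is a Euclidean space. *)
Section RootSystems.
Context {R : realType} {V : vectType R} (dot : {dot V for idfun}).
Implicit Types (E : {vspace V}) (Phi Psi Pi A Gamma : set V) (a b x : V).

Definition cartan_number b a : R := 2 * dot b a / dot a a.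

Definition reflect_root a b : V := b - cartan_number b a *: a.

Record root_system E Phi : Prop := RootSystem {
  root_finite : finite_set Phi;
  root_span : <<fset_set Phi>>%VS = E;
  root_neq0 : ~ Phi 0;
  root_reduced : forall a (c : R), Phi a -> Phi (c *: a) -> c = 1 \/ c = -1;
  root_reflect : forall a b, Phi a -> Phi b -> Phi (reflect_root a b);
  root_integral : forall a b, Phi a -> Phi b -> cartan_number b a \is a Num.int
}.

Definition nonneg_comb Pi x : Prop :=
  exists c : V -> nat, x = \sum_(a \in Pi) a *+ c a.

Record simple_roots E Phi Pi : Prop := SimpleRoots {
  simple_sub : Pi `<=` Phi;
  simple_basis : basis_of E (fset_set Pi);
  simple_sign : forall a, Phi a -> nonneg_comb Pi a \/ nonneg_comb Pi (- a)
}.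

Definition positive_roots Phi Pi : set V := Phi `&` nonneg_comb Pi.

(* A subsystem is a root system in its own span. *)
Definition root_subsystem Phi Psi : Prop :=
  Psi `<=` Phi /\ root_system <<fset_set Psi>>%VS Psi.

Definition generated_subsystem Phi A : set V := smallest (root_subsystem Phi) A.

Definition closed_roots Phi Gamma : Prop :=
  Gamma `<=` Phi /\
  forall a b, Gamma a -> Gamma b -> Phi (a + b) -> Gamma (a + b).

Definition orthogonal_sets A B : Prop := forall x y, A x -> B y -> dot x y = 0.

Definition gamma_set Phi Pi I J K : set V :=
  generated_subsystem Phi I `|`
  ((generated_subsystem Phi J `&` positive_roots Phi Pi)
     `\` generated_subsystem Phi K).

End RootSystems.

(* Main.v *)
Require Import Defs.
From mathcomp Require Import all_boot all_order all_algebra.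
From mathcomp Require Import finmap.
From mathcomp Require Import boolp classical_sets functions cardinality fsbigop.
From mathcomp Require Import reals.
From mathcomp Require Import ring lra zify.

Import Order.TTheory GRing.Theory Num.Theory.

Local Open Scope classical_set_scope.
Local Open Scope ring_scope.

Set Implicit Arguments.
Unset Strict Implicit.
Unset Printing Implicit Defensive.

(** Write [Phi_A] for the subsystem generated by a set [A] of simple roots, and
    say that a vector is supported in [A] when its coordinates in the basis of
    simple roots vanish outside [A]. Everything rests on the fact that [Phi_A]
    consists of the roots supported in [A] ([generated_subsystemE]), proved by
    descent on the height of a positive root. It turns membership in the set
    Gamma of the theorem into a condition on coordinates ([gamma_setE]).

    Suppose that [I `|` K] splits into orthogonal parts [X] and [Y] as required;
    then [X `<=` I] and [Y `<=` K]. A sum of two elements of Gamma could leave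
    Gamma only by having an element [b] of Gamma outside [Phi_I] and [Phi_K] as a
    term and falling into [Phi_K], the other term being in [Phi_I]. Then [b] would
    be supported in [X `|` Y]. A root supported in an orthogonal union is supported
    in one of the two parts ([root_supportedU]), so [b] would lie in [Phi_I] or
    in [Phi_K] ([gamma_closed]).

    Conversely, if Gamma is closed, let [X] be the union of the supports of the
    positive roots of [Phi_I] outside [Phi_K], and [Y] the rest of [I `|` K]. The
    inclusions are immediate. For the orthogonality, take such a root [g] and [y]
    in [Y]: distinct simple roots form obtuse angles, so (g, y) <= 0. If the
    inequality were strict, [g + y] would be a root ([root_add]), and either [y]
    would be in [X], or the sum of [- g] and [g + y] would contradict closedness
    ([linked_orthogonal]). *)

(** * Reflections, subsystems and sums of roots *)

Section Roots.
Context {R : realType} {V : vectType R} (dot : {dot V for idfun}).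
Context (Phi : set V) (hPhi : root_system dot fullv Phi).

Lemma dotC x y : dot x y = dot y x.
Proof. by rewrite hermC expr0 mul1r. Qed.

Lemma dot_gt0 x : x != 0 -> 0 < dot x x.
Proof. exact: neq0_dnorm_gt0. Qed.

Lemma root_norm_gt0 a : Phi a -> 0 < dot a a.
Proof.
by move=> Pa; apply/dot_gt0/eqP => a0; apply: (root_neq0 hPhi); rewrite -a0.
Qed.

Lemma reflect_root_self a : Phi a -> reflect_root dot a a = - a.
Proof.
move=> Pa; rewrite /reflect_root /cartan_number mulfK ?gt_eqF ?root_norm_gt0//.
by rewrite scaler_nat mulr2n opprD addrA subrr sub0r.
Qed.

Lemma root_opp a : Phi a -> Phi (- a).
Proof. by move=> Pa; rewrite -reflect_root_self//; exact: (root_reflect hPhi). Qed.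

Lemma reflect_rootK a : Phi a -> involutive (reflect_root dot a).
Proof.
move=> Pa b.
have cE : cartan_number dot (reflect_root dot a b) a = - cartan_number dot b a.
  rewrite /reflect_root {1}/cartan_number linearBl linearZl_LR /= /cartan_number.
  by field; rewrite gt_eqF ?root_norm_gt0.
by rewrite {1}/reflect_root cE scaleNr opprK subrK.
Qed.

(** Every other axiom of a root system passes from [Phi] to its subsets, so only
    stability under reflections has to be checked on a subsystem. *)
Lemma root_subsystemP Psi : root_subsystem dot Phi Psi <->
  Psi `<=` Phi /\ forall a b, Psi a -> Psi b -> Psi (reflect_root dot a b).
Proof.
split=> [[sub rs]|[sub refl]]; first by split=> // a b; exact: (root_reflect rs).
split=> //; split=> //.
- exact: sub_finite_set (root_finite hPhi).
- by move/sub; exact: (root_neq0 hPhi).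
- by move=> a c /sub Pa /sub; exact: (root_reduced hPhi).
- by move=> a b /sub Pa /sub; exact: (root_integral hPhi).
Qed.

Lemma generated_subsystem_reflect A a b :
  generated_subsystem dot Phi A a -> generated_subsystem dot Phi A b ->
  generated_subsystem dot Phi A (reflect_root dot a b).
Proof.
move=> ga gb Psi [rsPsi APsi]; have [_ refl] := (root_subsystemP Psi).1 rsPsi.
by apply: refl; [exact: ga|exact: gb].
Qed.

Lemma generated_subsystem_opp A a : Phi a ->
  generated_subsystem dot Phi A a -> generated_subsystem dot Phi A (- a).
Proof.
by move=> Pa ga; rewrite -reflect_root_self//; exact: generated_subsystem_reflect.
Qed.

Lemma cartan_lt0 a b : Phi a -> dot b a < 0 -> cartan_number dot b a < 0.
Proof. by move=> Pa ab; rewrite pmulr_llt0 ?invr_gt0 ?root_norm_gt0// pmulr_rlt0. Qed.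

Lemma cartan_gt0 a b : Phi a -> 0 < dot b a -> 0 < cartan_number dot b a.
Proof. by move=> Pa ab; rewrite divr_gt0 ?root_norm_gt0// mulr_gt0. Qed.

Lemma root_add_cartan a b : Phi a -> Phi b -> cartan_number dot b a = -1 ->
  Phi (a + b).
Proof.
move=> Pa Pb c; have := root_reflect hPhi Pa Pb.
by rewrite /reflect_root c scaleN1r opprK addrC.
Qed.

(** A negative Cartan integer different from -1 is at most -2. *)
Lemma dot_le_neg_norm a b : Phi a -> Phi b -> dot b a < 0 ->
  cartan_number dot b a != -1 -> dot b a <= - dot a a.
Proof.
move=> Pa Pb ab; have := cartan_lt0 Pa ab.
have /intrP[z cE] := root_integral hPhi Pa Pb.
rewrite cE -[-1]/((-1)%:~R) eqr_int ltrz0 => z0 z1.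
have : (z%:~R : R) <= (-2)%:~R by rewrite ler_int; lia.
rewrite -cE /cartan_number ler_pdivrMr ?root_norm_gt0//.
by rewrite [_%:~R]/(- 2%:R) mulNr -mulrN ler_pM2l.
Qed.

(** If neither Cartan integer of [a] and [b] were -1, both would be at most -2,
    so that (a, b) <= -(a, a) and (a, b) <= -(b, b), whence |a + b|^2 <= 0.
    Thus one of them is -1, and the corresponding reflection produces [a + b]. *)
Lemma root_add a b : Phi a -> Phi b -> a + b != 0 -> dot a b < 0 -> Phi (a + b).
Proof.
move=> Pa Pb ab0 ab; have ba : dot b a < 0 by rewrite dotC.
have [/eqP/(root_add_cartan Pa Pb)//|/dot_le_neg_norm Hba] :=
  boolP (cartan_number dot b a == -1).
have [/eqP/(root_add_cartan Pb Pa)|/dot_le_neg_norm Hab] :=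
  boolP (cartan_number dot a b == -1); first by rewrite addrC.
have := dot_gt0 ab0; rewrite linearDl !linearDr /= (dotC b a).
have := Hba Pa Pb ba; have := Hab Pb Pa ab; rewrite (dotC b a); lra.
Qed.

End Roots.

(** * Coordinates in the basis of simple roots *)

Section SimpleCoordinates.
Context {R : realType} {V : vectType R} (Pi : set V).

(** Coordinates are indexed by the vectors of [Pi] themselves; the sum has at
    most one term and vanishes when [a] is not in [Pi]. *)
Definition simple_coord (a x : V) : R :=
  \sum_(i < size (fset_set Pi) | (fset_set Pi)`_i == a)
     coord (in_tuple (fset_set Pi)) i x.

Definition supported (A : set V) (x : V) := forall a, ~ A a -> simple_coord a x = 0.

Definition nonneg_coords (x : V) := forall a, 0 <= simple_coord a x.

Lemma simple_coordD a x y :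
  simple_coord a (x + y) = simple_coord a x + simple_coord a y.
Proof. by rewrite -big_split; apply: eq_bigr => i _; rewrite linearD. Qed.

Lemma simple_coordZ a c x : simple_coord a (c *: x) = c * simple_coord a x.
Proof. by rewrite big_distrr; apply: eq_bigr => i _; rewrite linearZ. Qed.

Lemma simple_coordN a x : simple_coord a (- x) = - simple_coord a x.
Proof. by rewrite -scaleN1r simple_coordZ mulN1r. Qed.

Lemma simple_coord0 a : simple_coord a 0 = 0.
Proof. by rewrite -(scale0r 0) simple_coordZ mul0r. Qed.

Lemma simple_coord_sum a (s : seq V) (F : V -> V) :
  simple_coord a (\sum_(b <- s) F b) = \sum_(b <- s) simple_coord a (F b).
Proof.
elim/big_ind2: _ => [|x x' y y' <- <-|//]; first exact: simple_coord0.
exact: simple_coordD.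
Qed.

Lemma supportedD A x y : supported A x -> supported A y -> supported A (x + y).
Proof. by move=> sx sy a Aa; rewrite simple_coordD sx// sy// addr0. Qed.

Lemma supportedZ A c x : supported A x -> supported A (c *: x).
Proof. by move=> sx a Aa; rewrite simple_coordZ sx// mulr0. Qed.

Lemma supportedN A x : supported A x -> supported A (- x).
Proof. by move=> sx a Aa; rewrite simple_coordN sx// oppr0. Qed.

Lemma supported_sub A B x : A `<=` B -> supported A x -> supported B x.
Proof. by move=> AB sx a Ba; apply: sx => /AB. Qed.

Lemma not_supported A x : ~ supported A x -> exists2 a, ~ A a & simple_coord a x <> 0.
Proof. by move=> /existsNP[a /not_implyP[]]; exists a. Qed.

Lemma supported_reflect (dot : {dot V for idfun}) A a b :
  supported A a -> supported A b -> supported A (reflect_root dot a b).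
Proof. by move=> sa sb; apply/supportedD/supportedN/supportedZ. Qed.

Lemma simple_coord_reflect (dot : {dot V for idfun}) a b c :
  simple_coord c (reflect_root dot a b) =
  simple_coord c b - cartan_number dot b a * simple_coord c a.
Proof. by rewrite simple_coordD simple_coordN simple_coordZ. Qed.

End SimpleCoordinates.

(** * Signs and supports of roots *)

Section SimpleRoots.
Context {R : realType} {V : vectType R} (dot : {dot V for idfun}).
Context (Phi Pi : set V).
Context (hPhi : root_system dot fullv Phi) (hPi : simple_roots fullv Phi Pi).

Local Notation co := (simple_coord Pi).
Local Notation supp := (supported Pi).
Local Notation nonneg := (nonneg_coords Pi).

Lemma simple_finite : finite_set Pi.
Proof. exact: sub_finite_set (simple_sub hPi) (root_finite hPhi). Qed.

Lemma mem_simple a : (a \in fset_set Pi) = (a \in Pi).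
Proof. by rewrite in_fset_set; last exact: simple_finite. Qed.

Lemma simple_coord_simple a b : Pi b -> co a b = (a == b)%:R.
Proof.
move=> /mem_set; rewrite -mem_simple => bPi.
set s := enum_fset (fset_set Pi).
have bs : (index b s < size s)%N by rewrite index_mem.
have nb : s`_(Ordinal bs) = b by rewrite /= nth_index.
have co_b i : coord (in_tuple s) i b = (i == Ordinal bs)%:R.
  rewrite -{1}nb (coord_free (X := in_tuple s)) 1?eq_sym//.
  exact: basis_free (simple_basis hPi).
rewrite /simple_coord; under eq_bigr do rewrite co_b.
have [->|ab] := eqVneq a b.
  rewrite (bigD1 (Ordinal bs)) /=; last by rewrite nth_index.
  by rewrite eqxx big1 ?addr0// => i /andP[_ /negPf->].
rewrite big1// => i /eqP ia; case: eqVneq => // iE.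
by move: ab; rewrite -ia iE nb eqxx.
Qed.

Lemma simple_coord_out a x : ~ Pi a -> co a x = 0.
Proof.
move=> Pa; rewrite /simple_coord big1// => i /eqP ia; case: Pa.
by apply/set_mem; rewrite -mem_simple -ia mem_nth.
Qed.

Lemma simple_expansion x : x = \sum_(a <- fset_set Pi) co a x *: a.
Proof.
rewrite {1}(coord_basis (X := in_tuple (fset_set Pi)) (simple_basis hPi) (memvf x)).
rewrite [RHS](big_nth 0) big_mkord; apply: eq_bigr => i _; congr (_ *: _).
rewrite /simple_coord (bigD1 i)//= big1 ?addr0// => j /andP[/eqP ji jDi].
by move: jDi; rewrite -val_eqE /= -(nth_uniq 0 _ _ (fset_uniq (fset_set Pi))) ?ji ?eqxx.
Qed.

Lemma dot_expansion x y : dot x y = \sum_(a <- fset_set Pi) co a x * dot a y.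
Proof.
rewrite {1}(simple_expansion x) linear_sumlz; apply: eq_bigr => a _.
by rewrite linearZl_LR.
Qed.

Lemma simple_coord_inj x : (forall a, co a x = 0) -> x = 0.
Proof.
by move=> x0; rewrite (simple_expansion x) big1// => a _; rewrite x0 scale0r.
Qed.

Lemma supported_simple A a : Pi a -> A a -> supp A a.
Proof.
by move=> Pa Aa b Ab; rewrite simple_coord_simple//; case: eqVneq => // bE; case: Ab; rewrite bE.
Qed.

Lemma simple_supported A a : Pi a -> supp A a -> A a.
Proof.
move=> Pa sa; apply: contrapT => /sa/eqP.
by rewrite simple_coord_simple// eqxx oner_eq0.
Qed.

Lemma nonneg_comb_coords x : nonneg_comb Pi x -> nonneg x.
Proof.
move=> [c ->] a; rewrite fsbig_finite/=; last exact: simple_finite.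
rewrite simple_coord_sum big_seq; apply: sumr_ge0 => b; rewrite mem_simple => /set_mem Pb.
by rewrite -scaler_nat simple_coordZ simple_coord_simple// mulr_ge0.
Qed.

Lemma root_sign b : Phi b -> nonneg b \/ nonneg (- b).
Proof. by move=> /(simple_sign hPi)[]/nonneg_comb_coords; [left|right]. Qed.

(** The coordinates of a root all have the same sign, so a single positive one
    decides. *)
Lemma root_nonneg a b : Phi b -> 0 < co a b -> nonneg b.
Proof.
move=> /root_sign[//|/(_ a)]; rewrite simple_coordN oppr_ge0 => /le_lt_trans H /H.
by rewrite ltxx.
Qed.

(** A root with nonnegative coordinates cannot be the opposite of a nonnegative
    combination, as it would then be zero. *)
Lemma positive_rootsE b : positive_roots Phi Pi b <-> Phi b /\ nonneg b.
Proof.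
split=> [[Pb /nonneg_comb_coords]//|[Pb b0]]; split=> //.
have [//|/nonneg_comb_coords nb0] := simple_sign hPi Pb.
case: (root_neq0 hPhi); rewrite -(_ : b = 0)//; apply: simple_coord_inj => a.
by apply/eqP; rewrite eq_le b0 andbT -oppr_ge0 -simple_coordN nb0.
Qed.

(** Were (a, b) positive, the reflection of [a] in [b] would be a root whose
    coordinate is 1 at [a] and negative at [b]. *)
Lemma simple_obtuse a b : Pi a -> Pi b -> a != b -> dot a b <= 0.
Proof.
move=> Pa Pb ab; rewrite leNgt; apply/negP => ab0.
have Fa := simple_sub hPi Pa; have Fb := simple_sub hPi Pb.
have c0 := cartan_gt0 hPhi Fb ab0.
have /(root_nonneg (a := a)) := root_reflect hPhi Fb Fa.
rewrite simple_coord_reflect !simple_coord_simple// eqxx (negPf ab) mulr0 subr0.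
move=> /(_ ltr01)/(_ b); rewrite simple_coord_reflect !simple_coord_simple//.
by rewrite eqxx eq_sym (negPf ab) sub0r mulr1 oppr_ge0 leNgt c0.
Qed.

Lemma simple_term_le0 g y a : nonneg g -> Pi y -> co y g = 0 -> Pi a ->
  co a g * dot a y <= 0.
Proof.
move=> g0 Py yg Pa; have [->|ay] := eqVneq a y; first by rewrite yg mul0r.
by rewrite mulr_ge0_le0 ?simple_obtuse.
Qed.

Lemma simple_dot_le0 g y : nonneg g -> Pi y -> co y g = 0 -> dot g y <= 0.
Proof.
move=> g0 Py yg; rewrite dot_expansion big_seq; apply: sumr_le0 => a.
by rewrite mem_simple => /set_mem; exact: simple_term_le0.
Qed.

(** The sum computing (g, y) has no positive term, so when it is zero every
    simple root in the support of [g] is orthogonal to [y]. *)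
Lemma simple_orthogonal g y x : nonneg g -> Pi y -> co y g = 0 ->
  dot g y = 0 -> co x g <> 0 -> dot x y = 0.
Proof.
move=> g0 Py yg gy /eqP xg.
have Px : Pi x by apply: contrapT => nPx; rewrite simple_coord_out ?eqxx in xg.
have xs : x \in fset_set Pi by rewrite mem_simple mem_set.
move: gy; rewrite dot_expansion (big_rem x)//= => gy.
have rest : \sum_(a <- rem x (fset_set Pi)) co a g * dot a y <= 0.
  rewrite big_seq; apply: sumr_le0 => a /mem_rem; rewrite mem_simple => /set_mem.
  exact: simple_term_le0.
have := simple_term_le0 g0 Py yg Px; rewrite le_eqVlt => /orP[|]; last by lra.
by rewrite mulf_eq0 (negPf xg) => /eqP.
Qed.

Definition height x : R := \sum_(a <- fset_set Pi) co a x.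

(** Descent on the height. As (b, b) > 0, some simple [a] in [A] has (b, a) > 0.
    Unless [b] is [a], the reflection in [a] keeps [b] positive, because a
    coordinate away from [a] is unchanged, and lowers its height by a positive
    integer. *)
Lemma nonneg_generated n A b : A `<=` Pi -> Phi b -> supp A b -> nonneg b ->
  height b < n%:R -> generated_subsystem dot Phi A b.
Proof.
move=> APi; elim: n b => [|n IH] b Fb sb b0 hb.
  by move: hb; rewrite ltNge sumr_ge0.
(* Otherwise (b, b), expanded in simple roots, has no positive term. *)
have [a Aa ab] : exists2 a, A a & 0 < dot b a.
  apply: contrapT => no; have := root_norm_gt0 hPhi Fb.
  rewrite dot_expansion ltNge sumr_le0// => a _.
  have [Aa|/sb->] := pselect (A a); last by rewrite mul0r.
  rewrite mulr_ge0_le0// dotC leNgt; apply/negP => ab; apply: no; by exists a.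
have Pa := APi _ Aa; have Fa := simple_sub hPi Pa.
have ga : generated_subsystem dot Phi A a by move=> Psi [_]; apply.
(* If [b] is supported at [a] alone, reducedness forces [b = a]. *)
have [other|only] := pselect (exists2 c, c <> a & co c b <> 0); last first.
  have bE : b = co a b *: a.
    apply/eqP; rewrite -subr_eq0; apply/eqP/simple_coord_inj => c.
    rewrite simple_coordD simple_coordN simple_coordZ (simple_coord_simple _ Pa).
    have [->|/eqP ca] := eqVneq c a; first by rewrite mulr1 subrr.
    rewrite mulr0 subr0; apply: contrapT => cb; apply: only; by exists c.
  have [c1|cN1] : co a b = 1 \/ co a b = -1.
    by apply: (root_reduced hPhi Fa); rewrite -bE.
  - by rewrite bE c1 scale1r.
  - by have := b0 a; rewrite cN1 ler0N1.
case: other => c /eqP ca /eqP cb.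
pose b' := reflect_root dot a b.
have Fb' : Phi b' by exact: (root_reflect hPhi).
have gb' : generated_subsystem dot Phi A b'.
  apply: IH => //.
  - by apply: supported_reflect => //; exact: supported_simple.
  - apply: (root_nonneg (a := c)) => //.
    rewrite simple_coord_reflect (simple_coord_simple _ Pa) (negPf ca) mulr0 subr0.
    by rewrite lt_def cb b0.
  - have n1 : 1 <= cartan_number dot b a.
      have := cartan_gt0 hPhi Fa ab.
      have /intrP[z ->] := root_integral hPhi Fa Fb.
      by rewrite ltr0z ler1z.
    have ha : height a = 1.
      rewrite /height (bigD1_seq a) ?fset_uniq//= ?mem_simple ?mem_set//.
      rewrite (simple_coord_simple _ Pa) eqxx big1 ?addr0// => d da.
      by rewrite (simple_coord_simple _ Pa) (negPf da).
    suff -> : height b' = height b - cartan_number dot b a * height a.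
      by move: hb; rewrite ha -natr1; lra.
    rewrite /height; under eq_bigr do rewrite simple_coord_reflect.
    by rewrite big_split /= sumrN mulr_sumr.
by rewrite -(reflect_rootK hPhi Fa b); exact: generated_subsystem_reflect.
Qed.

(** The roots supported in [A] are stable under reflections, which gives one
    inclusion; the descent on heights, applied up to sign, gives the other. *)
Lemma generated_subsystemE A : A `<=` Pi ->
  generated_subsystem dot Phi A = Phi `&` supp A.
Proof.
move=> APi; apply/seteqP; split=> b.
  apply: smallest_sub => [|a Aa]; last first.
    split; first exact: (simple_sub hPi (APi _ Aa)).
    by apply: supported_simple => //; exact: APi.
  apply/(root_subsystemP hPhi); split=> [a []//|a c [Fa sa] [Fc sc]].
  by split; [exact: (root_reflect hPhi)|exact: supported_reflect].
have gpos c : Phi c -> supp A c -> nonneg c -> generated_subsystem dot Phi A c.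
  move=> Fc sc c0; apply: (@nonneg_generated (Num.bound (height c))) => //.
  by rewrite archi_boundP// sumr_ge0.
move=> [Fb sb]; have [|nb] := root_sign Fb; first exact: gpos.
rewrite -(opprK b); apply: (generated_subsystem_opp hPhi); first exact: (root_opp hPhi).
by apply: gpos => //; [exact: (root_opp hPhi)|exact: supportedN].
Qed.

(** A root does not spread over two orthogonal sets of simple roots: the roots
    supported in [X] and those supported in [Y] form together a subsystem,
    reflections of one part acting trivially on the other, and this subsystem
    contains [X `|` Y]. *)
Lemma root_supportedU X Y b : X `<=` Pi -> Y `<=` Pi ->
  orthogonal_sets dot X Y -> Phi b -> supp (X `|` Y) b -> supp X b \/ supp Y b.
Proof.
move=> XPi YPi oXY Fb sb.
have oS x y : supp X x -> supp Y y -> dot x y = 0.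
  move=> sx sy; rewrite dot_expansion big1// => a _.
  have [Xa|/sx->] := pselect (X a); last by rewrite mul0r.
  rewrite dotC dot_expansion big1 ?mulr0// => c _.
  have [Yc|/sy->] := pselect (Y c); last by rewrite mul0r.
  by rewrite dotC (oXY a c) ?mulr0.
have XYPi : X `|` Y `<=` Pi by rewrite subUset.
have fix_orth a c : dot c a = 0 -> reflect_root dot a c = c.
  by move=> ca; rewrite /reflect_root /cartan_number ca mulr0 mul0r scale0r subr0.
have : generated_subsystem dot Phi (X `|` Y) b by rewrite generated_subsystemE.
suff gen : generated_subsystem dot Phi (X `|` Y) `<=` Phi `&` (supp X `|` supp Y).
  by move=> /gen[].
apply: smallest_sub => [|a XYa]; last first.
  split; first exact: (simple_sub hPi (XYPi _ XYa)).
  case: XYa => [Xa|Ya]; [left|right]; apply: supported_simple => //.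
    exact: XPi.
  exact: YPi.
apply/(root_subsystemP hPhi); split=> [a []//|a c [Fa sa] [Fc sc]].
split; first exact: (root_reflect hPhi).
case: sa sc => sa [] sc.
- by left; exact: supported_reflect.
- by right; rewrite fix_orth// dotC oS.
- by left; rewrite fix_orth// oS.
- by right; exact: supported_reflect.
Qed.

(** * From an orthogonal decomposition to a closed set *)

Lemma gamma_setE I J K : I `<=` Pi -> J `<=` Pi -> K `<=` Pi ->
  gamma_set dot Phi Pi I J K =
  Phi `&` (supp I `|` ((supp J `&` nonneg) `\` supp K)).
Proof.
move=> hI hJ hK; rewrite /gamma_set !generated_subsystemE//.
apply/seteqP; split=> b.
  case=> [[Fb sb]|[[[Fb sb] /positive_rootsE[_ b0]] nK]]; split=> //; first by left.
  by right; split=> // sK; exact: nK.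
case=> Fb [sb|[[sb b0] nK]]; [by left|right; split].
  by split=> //; exact/positive_rootsE.
by case.
Qed.

(** The case that matters is a sum [a + b] with [a] in [Phi_I] and [b] positive,
    outside [Phi_I] and [Phi_K]. The sum is positive since [a] does not touch the
    support of [b] outside [I]. If the sum were in [Phi_K], then [b] would be
    supported in [I `|` K], hence in [X] or in [Y], that is, in [I] or in [K]. *)
Lemma gamma_closed I J K X Y :
  I `<=` Pi -> J `<=` Pi -> K `<=` Pi -> I `<=` J ->
  I `|` K = X `|` Y -> X `&` Y = set0 -> orthogonal_sets dot X Y ->
  I `\` K `<=` X -> K `\` I `<=` Y ->
  closed_roots Phi (gamma_set dot Phi Pi I J K).
Proof.
move=> hI hJ hK hIJ IKE XY0 oXY hX hY; rewrite gamma_setE//.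
have XI : X `<=` I.
  move=> x Xx; have [//|Kx] : (I `|` K) x by rewrite IKE; left.
  apply: contrapT => nI; have : (X `&` Y) x by split=> //; apply: hY.
  by rewrite XY0.
have YK : Y `<=` K.
  move=> y Yy; have [Iy|//] : (I `|` K) y by rewrite IKE; right.
  apply: contrapT => nK; have : (X `&` Y) y by split=> //; apply: hX.
  by rewrite XY0.
have mixed a b : supp I a -> Phi b -> (supp J `&` nonneg) b -> ~ supp K b ->
    Phi (a + b) -> (supp I `|` ((supp J `&` nonneg) `\` supp K)) (a + b).
  move=> sa Fb [sb b0] nK Fab.
  have [sIb|nI] := pselect (supp I b); first by left; exact: supportedD.
  right; split; [split|].
  - by apply: supportedD => //; exact: supported_sub hIJ sa.
  - have [c nIc /eqP bc] := not_supported nI.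
    apply: (root_nonneg (a := c)) => //.
    by rewrite simple_coordD sa// add0r lt_def bc b0.
  - move=> sKab; have sb' : supp (X `|` Y) b.
      rewrite -IKE -[b](addKr a).
      apply: supportedD; first by apply: supportedN; exact: supported_sub sa.
      by apply: supported_sub sKab; exact: subsetUr.
    have XPi := subset_trans XI hI; have YPi := subset_trans YK hK.
    have [sX|sY] := root_supportedU XPi YPi oXY Fb sb'.
    + by apply: nI; exact: supported_sub sX.
    + by apply: nK; exact: supported_sub sY.
split=> [a []//|a b [Fa ga] [Fb gb] Fab]; split=> //.
case: ga gb => [sa|[sa nKa]] [sb|[sb nKb]].
- by left; exact: supportedD.
- exact: mixed.
- by rewrite addrC; apply: mixed => //; rewrite addrC.
- right; split; [split|].
  + by apply: supportedD; [exact: sa.1|exact: sb.1].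
  + by move=> c; rewrite simple_coordD addr_ge0 ?sa.2 ?sb.2.
  + move=> sK; have [c nKc /eqP ac] := not_supported nKa.
    have := sK _ nKc; rewrite simple_coordD => /eqP.
    by rewrite paddr_eq0 ?sa.2 ?sb.2// (negPf ac).
Qed.

(** * From a closed set to an orthogonal decomposition *)

(** The elements of [I] that some positive root of [Phi_I] ties to [I `\` K]:
    in terms of the Dynkin diagram, the union of the connected components of [I]
    that are not contained in [K]. Describing it by supports of roots avoids
    paths in the diagram. *)
Definition linked (I K : set V) : set V :=
  [set x | exists g, [/\ Phi g, nonneg g, supp I g, ~ supp K g & co x g <> 0]].

Lemma linked_sub I K : linked I K `<=` I.
Proof. by move=> x [g [_ _ sI _ xg]]; apply: contrapT => /sI. Qed.

Lemma linked_diff I K : I `<=` Pi -> I `\` K `<=` linked I K.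
Proof.
move=> hI x [Ix nKx]; have Px := hI _ Ix; exists x; split.
- exact: (simple_sub hPi Px).
- by move=> a; rewrite simple_coord_simple.
- exact: supported_simple.
- by move/(simple_supported Px).
- by rewrite simple_coord_simple// eqxx; apply/eqP/oner_neq0.
Qed.

(** Let [g] witness that [x] is linked and suppose (g, y) < 0. Then [g + y] is a
    positive root outside [Phi_K]. If [y] is in [I], this root shows that [y] is
    linked. If not, [y] = [-g] + ([g + y]) is a sum of elements of the closed set,
    although it belongs to [Phi_K] and not to [Phi_I]. Hence (g, y) = 0, and all of
    the support of [g] is orthogonal to [y]. *)
Lemma linked_orthogonal I J K :
  I `<=` Pi -> J `<=` Pi -> K `<=` Pi -> I `<=` J -> K `<=` J ->
  closed_roots Phi (gamma_set dot Phi Pi I J K) ->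
  orthogonal_sets dot (linked I K) ((I `|` K) `\` linked I K).
Proof.
move=> hI hJ hK hIJ hKJ; rewrite gamma_setE// => -[_ cl] x y xX [IKy nXy].
have [g [Fg g0 sI nK xg]] := xX.
have Py : Pi y by case: IKy => [/hI|/hK].
have Fy := simple_sub hPi Py.
have yg : co y g = 0 by apply: contrapT => yg; apply: nXy; exists g.
have [k nKk /eqP kg] := not_supported nK.
have Ky : K y.
  by case: IKy => // Iy; apply: contrapT => nKy; apply: nXy; exact: linked_diff.
have kDy : k != y by apply/eqP => ky; apply: nKk; rewrite ky.
have coy c : co c (g + y) = co c g + (c == y)%:R.
  by rewrite simple_coordD (simple_coord_simple _ Py).
have nKgy : ~ supp K (g + y).
  by move=> /(_ _ nKk)/eqP; rewrite coy (negPf kDy) addr0 (negPf kg).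
have gy0 : nonneg (g + y) by move=> c; rewrite coy addr_ge0.
apply: (simple_orthogonal g0 Py yg _ xg); apply/eqP.
rewrite eq_le simple_dot_le0//= leNgt; apply/negP => gy.
have Fgy : Phi (g + y).
  apply: (root_add hPhi) => //; apply/eqP => gyE.
  by apply: nKgy => c _; rewrite gyE simple_coord0.
have [Iy|nIy] := pselect (I y).
  apply: nXy; exists (g + y); split=> //.
    by apply: supportedD => //; exact: supported_simple.
  by rewrite coy yg eqxx add0r; apply/eqP/oner_neq0.
have sJ : supp J (g + y).
  apply: supportedD; first exact: supported_sub sI.
  by apply: supported_simple => //; exact: hKJ.
have [] := cl (- g) (g + y).
- by split; [exact: (root_opp hPhi)|left; exact: supportedN].
- by split=> //; right.
- by rewrite addKr.
rewrite addKr => _ [/(simple_supported Py)//|[_ nKy]].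
by apply: nKy; exact: supported_simple.
Qed.

End SimpleRoots.

Theorem proposition3p2 (R : realType) (V : vectType R) (dot : {dot V for idfun})
    (Phi Pi : set V)
    (hPhi : root_system dot fullv Phi) (hPi : simple_roots fullv Phi Pi)
    (I J K : set V)
    (hI : I `<=` Pi) (hJ : J `<=` Pi) (hK : K `<=` Pi)
    (hIJ : I `<=` J) (hKJ : K `<=` J) :
  closed_roots Phi (gamma_set dot Phi Pi I J K) <->
  exists X Y : set V,
    [/\ X `<=` J, Y `<=` J,
        I `|` K = X `|` Y /\ X `&` Y = set0,
        orthogonal_sets dot X Y &
        I `\` K `<=` X /\ K `\` I `<=` Y].
Proof.
split=> [cl|[X [Y [_ _ [IKE XY0] oXY [hX hY]]]]]; last exact: gamma_closed oXY hX hY.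
have XI := @linked_sub _ _ Phi Pi I K.
exists (linked Phi Pi I K), ((I `|` K) `\` linked Phi Pi I K); split.
- exact: subset_trans XI hIJ.
- by move=> y [[/hIJ|/hKJ]].
- by split; [rewrite setDUK// => x /XI; left|rewrite setDIK].
- exact: (linked_orthogonal hPhi hPi hI hJ).
- split; first exact: (linked_diff hPhi hPi).
  by move=> y [Ky nIy]; split; [right|move/XI].
Qed.
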